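(* Let $\mathcal{H}$ be a hypergraph on a finite vertex set $V$ that is circular-arc, twin-free, and strictly overlap-connected. Then $\mathcal{H}$ has, up to reversal, a unique arc ordering.
   Context: A hypergraph $\mathcal{H}$ consists of a finite vertex set $V=V(\mathcal{H})$ and a family of subsets of $V$ called hyperedges; $\mathcal{H}$ also denotes its set of hyperedges. A circular ordering of $V=\{v_1,\dots,v_n\}$ is given by a circular successor relation ($v_i$ is followed by $v_{i+1}$, and $v_n$ by $v_1$); an arc is a set of consecutive vertices in this circular order (the empty set and $V$ itself are also arcs). An arc ordering of $\mathcal{H}$ is a circular ordering of $V$ in which every hyperedge is an arc; $\mathcal{H}$ is circular-arc (CA) if it admits an arc ordering. Uniqueness ''up to reversal'' means any two arc orderings are equal or reverses of each other. Two distinct vertices are twins if every hyperedge contains both or neither of them; $\mathcal{H}$ is twin-free if it has no twins. Two sets $A,B\subseteq V$ overlap if $A\cap B\neq\emptyset$, $A\not\subseteq B$ and $B\not\subseteq A$; they strictly overlap if they overlap and $A\cup B\neq V$. $\mathcal{H}$ is strictly overlap-connected if every vertex lies in some hyperedge and the graph on the set of hyperedges in which two hyperedges are adjacent iff they strictly overlap is connected. *)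

(* Defs.v *)
From HB Require Import structures.
From mathcomp Require Import all_boot all_fingroup.

Set Implicit Arguments.
Unset Strict Implicit.
Unset Printing Implicit Defensive.

(* A hypergraph on the finite vertex set V is given by its set of hyperedges
   H : {set {set V}}; isolated vertices and the empty hyperedge are allowed. *)

(* The circular successor relation of v_1, ..., v_n is encoded by its successor
   function, a permutation s: here c = [:: v_1; ...; v_n] enumerates V without
   repetition and fcycle s c says that s v_i = v_(i+1) and s v_n = v_1.
   The reversed ordering is s^-1. *)
Definition circular_ordering (V : finType) (s : {perm V}) : Prop :=
  exists c : seq V, [/\ uniq c, forall x, x \in c & fcycle s c].

(* traject s x k = [:: x; s x; ...; s^(k-1) x]; the case A = set0 is listed
   separately because V may be empty. *)
Definition arc (V : finType) (s : {perm V}) (A : {set V}) : Prop :=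
  A = set0 \/ exists (x : V) (k : nat), A = [set y in traject s x k].

Definition arc_ordering (V : finType) (H : {set {set V}}) (s : {perm V}) :
    Prop :=
  circular_ordering s /\ forall A, A \in H -> arc s A.

Definition circular_arc (V : finType) (H : {set {set V}}) : Prop :=
  exists s : {perm V}, arc_ordering H s.

Definition unique_arc_ordering_up_to_reversal
    (V : finType) (H : {set {set V}}) : Prop :=
  (exists s : {perm V}, arc_ordering H s) /\
  (forall s t : {perm V}, arc_ordering H s -> arc_ordering H t ->
     t = s \/ t = (s^-1)%g).

Definition twins (V : finType) (H : {set {set V}}) (x y : V) : Prop :=
  x <> y /\ forall A, A \in H -> (x \in A) = (y \in A).

Definition twin_free (V : finType) (H : {set {set V}}) : Prop :=
  forall x y : V, ~ twins H x y.

Definition overlap (V : finType) (A B : {set V}) : bool :=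
  [&& A :&: B != set0, ~~ (A \subset B) & ~~ (B \subset A)].

Definition strictly_overlap (V : finType) (A B : {set V}) : bool :=
  overlap A B && (A :|: B != setT).

Definition strict_overlap_graph (V : finType) (H : {set {set V}}) :
    rel {set V} :=
  [rel A B | [&& A \in H, B \in H & strictly_overlap A B]].

(* The empty graph counts as connected, which only matters when V is empty,
   since hyperedges must cover V. *)
Definition strictly_overlap_connected (V : finType) (H : {set {set V}}) :
    Prop :=
  (forall x : V, exists2 A, A \in H & x \in A) /\
  (forall A B, A \in H -> B \in H -> connect (strict_overlap_graph H) A B).

(* Main.v *)
(** Fix a vertex [v0] and replace every hyperedge containing [v0] by its
    complement. Arc orderings become linear orderings of the other vertices in
    which the hyperedges are intervals, and strict overlap becomes overlap.
    If [A] and [C] both overlap [B], they lie on the same side of [B] iff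
    [(A :&: C) :\: B] is nonempty, a condition that does not mention the
    ordering. Hence two orderings agree on the orientation of all overlapping
    pairs or disagree on all of them, and following a path of overlapping
    hyperedges from an interval separating two vertices transfers this to the
    order of these vertices. *)
Require Import Defs.
From HB Require Import structures.
From mathcomp Require Import all_boot all_fingroup.
From mathcomp Require Import zify.

Set Implicit Arguments.
Unset Strict Implicit.
Unset Printing Implicit Defensive.

(** * Intervals of an injective numbering *)

Section Intervals.

Variables (V : finType).
Implicit Types (f g : V -> nat) (A B C : {set V}) (x y z : V).

Definition interval f A :=
  forall x y z, x \in A -> z \in A -> f x < f y -> f y < f z -> y \in A.

Lemma overlapP A B :
  reflect (exists x y z, [/\ x \in A, x \notin B & [/\ y \in A, y \in B,
             z \in B & z \notin A]])
          (overlap A B).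
Proof.
apply: (iffP and3P) => [[/set0Pn[y /setIP[yA yB]]] | ].
  by move=> /subsetPn[x xA xB] /subsetPn[z zB zA]; exists x, y, z.
move=> [x [y [z [xA xB [yA yB zB zA]]]]]; split.
- by apply/set0Pn; exists y; rewrite inE yA.
- by apply/subsetPn; exists x.
- by apply/subsetPn; exists z.
Qed.

Lemma overlapC A B : overlap A B = overlap B A.
Proof. by rewrite /overlap setIC; congr andb; rewrite andbC. Qed.

Lemma ltn_inj_total f x y :
  injective f -> x != y -> (f x < f y) = ~~ (f y < f x).
Proof. by move=> fI xy; case: ltngtP => // /fI/eqP; rewrite (negPf xy). Qed.

Lemma neq_mem A x y : x \in A -> y \notin A -> y != x.
Proof. by move=> xA; apply: contraNneq => ->. Qed.

Lemma interval_side f A x y z : injective f -> interval f A ->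
  x \notin A -> y \in A -> z \in A -> (f x < f y) = (f x < f z).
Proof.
move=> fI fA; wlog: y z / f x < f y => [W | xy] xA yA zA.
  case xy: (f x < f y); first by rewrite -xy; apply: W.
  by case xz: (f x < f z) => //; rewrite -xz -xy; apply/esym/W.
rewrite xy (ltn_inj_total fI (neq_mem zA xA)); apply/esym/negP => zx.
by move/negP: xA; apply; apply: fA zx xy.
Qed.

(** A point [w] of [B :\: A] links the two comparisons: all of [B] lies on one side of [x] and of
    [x'], and all of [A] on one side of [w]. *)
Lemma overlap_side f A B x x' y y' : injective f ->
  interval f A -> interval f B -> overlap A B ->
  x \in A -> x \notin B -> x' \in A -> x' \notin B -> y \in B -> y' \in B ->
  (f x < f y) = (f x' < f y').
Proof.
move=> fI fA fB /overlapP[_ [z [w [_ _ [zA zB wB wA]]]]].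
move=> xA xB x'A x'B yB y'B.
rewrite (interval_side fI fB xB yB wB) (interval_side fI fB x'B y'B wB).
rewrite (ltn_inj_total fI (neq_mem wB xB)) (ltn_inj_total fI (neq_mem wB x'B)).
by rewrite (interval_side fI fA wA xA x'A).
Qed.

Definition before f A B := [forall x in A :\: B, forall y in B, f x < f y].

Lemma beforeE f A B x y : injective f -> interval f A -> interval f B ->
  overlap A B -> x \in A -> x \notin B -> y \in B ->
  before f A B = (f x < f y).
Proof.
move=> fI fA fB oAB xA xB yB; apply/idP/idP.
  by move=> /forall_inP/(_ x); rewrite inE xA xB => /(_ isT)/forall_inP; apply.
move=> xy; apply/forall_inP => x' /setDP[x'A x'B]; apply/forall_inP => y' y'B.
by rewrite -(overlap_side fI fA fB oAB xA xB x'A x'B yB y'B).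
Qed.

Lemma before_antisym f A B : injective f -> interval f A -> interval f B ->
  overlap A B -> before f B A = ~~ before f A B.
Proof.
move=> fI fA fB oAB; have oBA : overlap B A by rewrite overlapC.
have /overlapP[x [_ [z [xA xB [_ _ zB zA]]]]] := oAB.
rewrite (beforeE fI fA fB oAB xA xB zB) (beforeE fI fB fA oBA zB zA xA).
exact/(ltn_inj_total fI)/(neq_mem xA).
Qed.

(** If a point of [A] and a point of [C] lie outside [B] on the same side of it, the one nearer to
    [B] is between the other and [B], hence in both [A] and [C]. *)
Lemma same_sideE f A B C : injective f ->
  interval f A -> interval f B -> interval f C -> overlap A B -> overlap C B ->
  (before f A B == before f C B) = ((A :&: C) :\: B != set0).
Proof.
move=> fI fA fB fC oAB oCB.
have /overlapP[x [a [_ [xA xB [aA aB _ _]]]]] := oAB.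
have /overlapP[z [c [_ [zC zB [cC cB _ _]]]]] := oCB.
apply/eqP/set0Pn => [|[p]]; last first.
  rewrite !inE => /and3P[pB pA pC].
  by rewrite (beforeE fI fA fB oAB pA pB aB) (beforeE fI fC fB oCB pC pB aB).
have [Exz _|xz] := eqVneq x z; first by exists x; rewrite !inE xA xB Exz.
rewrite (beforeE fI fA fB oAB xA xB aB) (beforeE fI fC fB oCB zC zB aB) => Eza.
have Exc := interval_side fI fB xB aB cB.
have Ezc := interval_side fI fB zB aB cB.
suff [zA|xC] : z \in A \/ x \in C.
- by exists z; rewrite !inE zB zA zC.
- by exists x; rewrite !inE xB xA xC.
have : f x != f z by rewrite (inj_eq fI).
have : f x != f a by rewrite (inj_eq fI) (neq_mem aB xB).
have : f z != f a by rewrite (inj_eq fI) (neq_mem aB zB).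
have : f x != f c by rewrite (inj_eq fI) (neq_mem cB xB).
have : f z != f c by rewrite (inj_eq fI) (neq_mem cB zB).
have zA := fA x z a xA aA; have zA' := fA a z x aA xA.
have xC := fC z x c zC cC; have xC' := fC c x z cC zC.
move: Eza Exc Ezc zA zA' xC xC'.
by case: (ltngtP (f x) (f z)); case: (ltngtP (f x) (f a));
  case: (ltngtP (f z) (f a)); case: (ltngtP (f x) (f c));
  case: (ltngtP (f z) (f c)) => //; auto.
Qed.

(** * Two numberings with the same intervals *)

Section TwoOrders.

Variables (f g : V -> nat) (E : {set {set V}}).
Hypotheses (fI : injective f) (gI : injective g).
Hypotheses (fE : forall A, A \in E -> interval f A).
Hypotheses (gE : forall A, A \in E -> interval g A).

Let edge := [rel A B | [&& A \in E, B \in E & overlap A B]].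
Let agree A B := before f A B == before g A B.

Lemma agreeC A B : edge A B -> agree A B = agree B A.
Proof.
move=> /and3P[AE BE oAB]; rewrite /agree.
rewrite (before_antisym fI (fE AE) (fE BE) oAB).
rewrite (before_antisym gI (gE AE) (gE BE) oAB).
by do 2!case: before.
Qed.

(** By [same_sideE], whether [A] and [C] are on the same side of [B] has one answer for both [f] and
    [g]. *)
Lemma agree_neighbours A B C : edge A B -> edge C B -> agree A B = agree C B.
Proof.
move=> /and3P[AE BE oAB] /and3P[CE _ oCB]; rewrite /agree.
have := same_sideE fI (fE AE) (fE BE) (fE CE) oAB oCB.
rewrite -(same_sideE gI (gE AE) (gE BE) (gE CE) oAB oCB).
by do 4!case: before.
Qed.

Hypothesis E_connected : forall A B, A \in E -> B \in E -> connect edge A B.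

Lemma edgeC A B : edge A B = edge B A.
Proof. by rewrite /= overlapC andbCA. Qed.

Lemma agree_const A B A' B' : edge A B -> edge A' B' -> agree A' B' = agree A B.
Proof.
move=> AB A'B'; have /and3P[_ BE _] := AB; have /and3P[_ B'E _] := A'B'.
have /connectP[p] := E_connected BE B'E.
elim: p A B AB {BE} => [|C p IHp] A B AB /=.
  by move=> _ EB; rewrite EB in A'B' *; apply: agree_neighbours.
move=> /andP[BC Cp] EB'; rewrite (IHp _ _ BC Cp EB') (agreeC BC).
by apply: agree_neighbours; rewrite // edgeC.
Qed.

Lemma agree_all : exists b, forall A B, edge A B -> agree A B = b.
Proof.
have [/existsP[A0 /existsP[B0 e0]]|none] := boolP [exists A, exists B, edge A B].
  by exists (agree A0 B0) => A B AB; apply: agree_const.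
(* Without overlapping pairs the value of [b] is arbitrary. *)
exists true => A B AB; case/negP: none.
by apply/existsP; exists A; apply/existsP; exists B.
Qed.

Lemma interval_order_unique :
  exists b, forall x y,
    (exists2 A, A \in E & x \in A) -> (exists2 A, A \in E & y \in A) ->
    (exists2 A, A \in E & (x \in A) != (y \in A)) ->
    (f x < f y) = ((g x < g y) == b).
Proof.
have [b agreeb] := agree_all; exists b.
(* Follow a path from [A], which misses [x], to some [B] containing [x]. While the next set [C] also
   misses [x], replace [y] by a point of [A :&: C], which is on the same side of [x]. *)
have sep A x y : A \in E -> (exists2 B, B \in E & x \in B) ->
    x \notin A -> y \in A -> (f x < f y) = ((g x < g y) == b).
  move=> AE [B BE xB]; have /connectP[p] := E_connected AE BE.
  elim: p A AE y => [|C p IHp] A AE y /=; first by move=> _ <-; rewrite xB.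
  move=> /andP[AC Cp] EB xA yA; have /and3P[_ CE oAC] := AC.
  have /overlapP[_ [z [_ [_ _ [zA zC _ _]]]]] := oAC.
  have [xC|xC] := boolP (x \in C); last first.
    rewrite (interval_side fI (fE AE) xA yA zA).
    rewrite (interval_side gI (gE AE) xA yA zA).
    exact: IHp Cp EB xC zC.
  (* Once [C] contains [x], its orientation against [A] is the comparison of [x] with [y]. *)
  have oCA : overlap C A by rewrite overlapC.
  have := agreeb C A; rewrite edgeC => /(_ AC); rewrite /agree.
  rewrite (beforeE fI (fE CE) (fE AE) oCA xC xA yA).
  rewrite (beforeE gI (gE CE) (gE AE) oCA xC xA yA) => <-.
  by do 2!case: (_ < _).
move=> x y xE yE [A AE]; case xA: (x \in A); case yA: (y \in A) => // _.
  have yx : y != x by apply: neq_mem xA _; rewrite yA.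
  rewrite (ltn_inj_total fI) 1?(ltn_inj_total gI) 1?eq_sym //.
  rewrite (sep A y x) ?yA //.
  by case: (_ < _); case: b {agreeb sep}.
by apply: (sep A); rewrite ?xA.
Qed.

End TwoOrders.

End Intervals.

(** * Circular orderings cut open at a vertex *)

Section Position.

Variable V : finType.
Implicit Types (s t : {perm V}) (f g : V -> nat) (A : {set V}).

Definition position s (v0 : V) f :=
  [/\ injective f, f v0 = 0, forall x, f x < #|V|
    & forall x, f (s x) = if (f x).+1 == #|V| then 0 else (f x).+1].

Lemma circular_ordering_position s v0 :
  circular_ordering s -> exists f, position s v0 f.
Proof.
move=> [c [Uc allc sc]]; have [i c' Ec'] := rot_to (allc v0).
have Uc' : uniq (v0 :: c') by rewrite -Ec' rot_uniq.
have allc' x : x \in v0 :: c' by rewrite -Ec' mem_rot.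
have size_c' : size (v0 :: c') = #|V|.
  by rewrite -(card_uniqP Uc'); apply: eq_card => x; rewrite allc'.
have : fcycle s (v0 :: c') by rewrite -Ec' rot_cycle.
rewrite /= => sc'.
(* A closed [s]-path is the trajectory of its starting point. *)
have Etr : v0 :: c' = traject s v0 #|V| /\ iter #|V| s v0 = v0.
  move/fpathP: sc' => [k Ek].
  have /= Ek1 := congr1 size Ek; rewrite size_rcons size_traject in Ek1.
  rewrite -{}Ek1 trajectSr in Ek; have [Ec Ev] := rcons_inj Ek.
  by rewrite -size_c' /= -Ec -iterS iterSr -Ev.
case: Etr => Etr En.
have iterK j : j < #|V| -> index (iter j s v0) (v0 :: c') = j.
  move=> lj; rewrite -(nth_traject s lj) -Etr index_uniq ?size_c' //.
have ltf x : index x (v0 :: c') < #|V| by rewrite -size_c' index_mem.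
have fK x : iter (index x (v0 :: c')) s v0 = x.
  by rewrite -(nth_traject s (ltf x)) -Etr nth_index.
exists (index^~ (v0 :: c')); split=> [x y Exy||//|x].
- by rewrite -(fK x) [index x _]Exy fK.
- by rewrite /= eqxx.
rewrite -{1}(fK x) -iterS; case: eqP => [->|/eqP ne].
  by rewrite En /= eqxx.
by rewrite iterK // ltn_neqAle ne ltf.
Qed.

(** Being injective and bounded by [#|V|], [f] is a bijection onto the numbers below [#|V|]; it can
    therefore be recovered from the order it induces. *)
Lemma position_card s v0 f x : position s v0 f -> #|[set y | f y < f x]| = f x.
Proof.
move=> [fI _ ltf _]; pose h y := Ordinal (ltf y).
have hI : injective h by move=> y z /(congr1 val)/fI.
have [h' hK h'K] : bijective h by apply: inj_card_bij => //; rewrite card_ord.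
rewrite -(card_imset _ hI) -[RHS]card_ord.
have le_x : f x <= #|V| by apply: ltnW.
have wI : injective (widen_ord le_x).
  by move=> i j /(congr1 val) /= /val_inj.
rewrite -(card_imset _ wI).
apply: eq_card => i; apply/imsetP/imsetP => [[y]|[j _ ->]].
  by rewrite inE => ly ->; exists (Ordinal ly) => //; apply: val_inj.
exists (h' (widen_ord le_x j)); rewrite ?h'K // inE.
by rewrite -[f _]/(val (h _)) h'K /=.
Qed.

(** As [v0] comes first in both numberings, the order of the other vertices determines all ranks,
    and these determine the successor. *)
Lemma position_order_inj s t v0 f g : position s v0 f -> position t v0 g ->
  (forall x y, x != v0 -> y != v0 -> x != y -> (f x < f y) = (g x < g y)) ->
  s = t.
Proof.
move=> sf tg fg.
have Efg x : f x = g x.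
  rewrite -(position_card x sf) -(position_card x tg); apply: eq_card => y.
  rewrite !inE; case: sf tg => [fI f0 _ _] [gI g0 _ _].
  have [->|yx] := eqVneq y x; first by rewrite !ltnn.
  have [y0|y0] := eqVneq y v0; last have [->|x0] := eqVneq x v0.
  - have := ltn_inj_total fI yx; have := ltn_inj_total gI yx.
    by rewrite y0 f0 g0 !ltn0 => -> ->.
  - by rewrite f0 g0.
  - exact: fg.
apply/permP => x; case: sf tg => [fI _ _ fs] [_ _ _ gt].
by apply: fI; rewrite fs (Efg (t x)) gt Efg.
Qed.

(** The case distinction keeps [v0] at 0, where the subtraction would give the out-of-range value
    [#|V|]. *)
Lemma position_inv s v0 f : position s v0 f ->
  position s^-1%g v0 (fun x => if x == v0 then 0 else #|V| - f x).
Proof.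
move=> [fI f0 ltf fs]; have f_eq0 x : (x == v0) = (f x == 0).
  by rewrite -f0 (inj_eq fI).
have n0 : 0 < #|V| by rewrite (leq_trans _ (ltf v0)).
split=> [x y||x|x].
- rewrite !f_eq0 => Exy; apply: fI; move: (ltf x) (ltf y) Exy.
  by do 2!case: eqP => ?; lia.
- by rewrite /= eqxx.
- by rewrite f_eq0; move: (ltf x); case: eqP; lia.
- have := fs (s^-1%g x); rewrite permKV !f_eq0.
  move: (ltf x) (ltf (s^-1%g x)).
  by case: (f (s^-1%g x) =P 0); case: (f x =P 0); do 2!case: eqP; lia.
Qed.

(** The conditional is the number of successor steps from [x] to [y]; its second branch passes
    through [v0]. *)
Lemma mem_arc s v0 f x k y : position s v0 f ->
  (y \in traject s x k) =
  ((if f x <= f y then f y - f x else f y + #|V| - f x) < k).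
Proof.
move=> [fI _ ltf fs].
elim: k x => [|k IHk] x; first by rewrite ltn0.
rewrite trajectS inE IHk fs -(inj_eq fI).
move: (ltf x) (ltf y); case: eqP => ?; case: eqP => ?;
  rewrite ?leq0n; do 2?case: ifP; lia.
Qed.

End Position.

(** * From arcs to intervals by complementation *)

Section Flip.

Variables (V : finType) (v0 : V).
Implicit Types (A B : {set V}).

Definition flip A := if v0 \in A then ~: A else A.

Lemma mem_flip A x : (x \in flip A) = ((x \in A) != (v0 \in A)).
Proof. by rewrite /flip; case: ifP; rewrite ?inE; case: (x \in A). Qed.

(** An arc avoiding [v0] does not cross the cut, and the complement of an arc through [v0] is such
    an arc. *)
Lemma arc_flip_interval s f A :
  position s v0 f -> Defs.arc s A -> interval f (flip A).
Proof.
move=> sf [->|[a [k ->]]] x y z; rewrite !mem_flip !inE //.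
rewrite !(mem_arc _ _ _ sf); case: sf => [_ -> ltf _].
move: (ltf a) (ltf x) (ltf y) (ltf z).
by do 4!case: ifP => ?; do 4!case: ltnP => ?; lia.
Qed.

(** Strict overlap makes all four cells of the Venn diagram of [A] and [B] nonempty, and
    complementing either set only permutes the cells. *)
Lemma overlap_flip A B : strictly_overlap A B -> overlap (flip A) (flip B).
Proof.
move=> /andP[/overlapP[x [y [z [xA xB [yA yB zB zA]]]]]].
rewrite -subTset => /subsetPn[w _]; rewrite inE negb_or => /andP[wA wB].
move/negPf in xB; move/negPf in zA; move/negPf in wA; move/negPf in wB.
apply/overlapP; case v0A: (v0 \in A); case v0B: (v0 \in B);
  [exists z, w, x | exists w, z, y | exists y, x, w | exists x, y, z];
  by rewrite !mem_flip v0A v0B ?(xA, xB, yA, yB, zA, zB, wA, wB).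
Qed.

Lemma connect_flip (H : {set {set V}}) A B :
  connect (strict_overlap_graph H) A B ->
  connect [rel A B | [&& A \in flip @: H, B \in flip @: H & overlap A B]]
    (flip A) (flip B).
Proof.
move=> /connectP[p + ->] {B}; elim: p A => [|C p IHp] A /=.
  by rewrite connect0.
move=> /andP[/and3P[AH CH AC] /IHp]; apply: connect_trans.
by apply: connect1; rewrite /= !imset_f //= overlap_flip.
Qed.

End Flip.

Lemma twin_free_sep (V : finType) (H : {set {set V}}) x y :
  twin_free H -> x != y -> exists2 A, A \in H & (x \in A) != (y \in A).
Proof.
move=> tf xy; apply/exists_inP.
apply/contraT => /exists_inPn none; case: (tf x y).
split=> [|A AH]; first exact/eqP.
exact/eqP/negPn/none.
Qed.

Theorem theorem1p2 (V : finType) (H : {set {set V}})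
  (hCA : circular_arc H)
  (htwin : twin_free H)
  (hconn : strictly_overlap_connected H) :
  unique_arc_ordering_up_to_reversal H.
Proof.
split=> // s t [sc sH] [tc tH].
have [v0 _|noV] := pickP (@predT V); last first.
  by left; apply/permP => x; have := noV x.
have [f sf] := circular_ordering_position v0 sc.
have [g tg] := circular_ordering_position v0 tc.
have [fI _ _ _] := sf; have [gI g0 ltg _] := tg.
have [A|A|A B|b Eb] := @interval_order_unique V f g (flip v0 @: H) fI gI.
- by move=> /imsetP[B BH ->]; apply: arc_flip_interval sf (sH _ BH).
- by move=> /imsetP[B BH ->]; apply: arc_flip_interval tg (tH _ BH).
- by move=> /imsetP[A' AH ->] /imsetP[B' BH ->]; apply/connect_flip/hconn.2.
have sep x y : x != y ->
    exists2 A, A \in flip v0 @: H & (x \in A) != (y \in A).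
  move=> /(twin_free_sep htwin)[A AH xyA]; exists (flip v0 A).
    exact: imset_f.
  by move: xyA; rewrite !mem_flip; do 3!case: (_ \in A).
(* Flipped hyperedges avoid [v0], so one that separates [x] from [v0] contains [x]. *)
have cov x : x != v0 -> exists2 A, A \in flip v0 @: H & x \in A.
  move=> /sep[A AH xA]; exists A => //; case/imsetP: AH xA => B _ ->.
  by rewrite !mem_flip; do 2!case: (_ \in B).
have Efg x y : x != v0 -> y != v0 -> x != y -> (f x < f y) = ((g x < g y) == b).
  by move=> x0 y0 xy; apply: Eb; [apply: cov|apply: cov|apply: sep].
case: b Efg {Eb} => Efg; [left|right].
  apply/esym/(position_order_inj sf tg) => x y x0 y0 xy.
  by rewrite Efg // eqb_id.
(* For [b = false], compare [f] with the numbering [#|V| - g] of the inverse of [t]; since [g] stays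
   below [#|V|], the truncated subtraction strictly reverses the order. *)
rewrite (position_order_inj sf (position_inv tg)) ?invgK // => x y x0 y0 xy.
rewrite (negPf x0) (negPf y0) Efg // eqbF_neg -(ltn_inj_total gI) 1?eq_sym //.
by move: (ltg x) (ltg y); lia.
Qed.
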